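(* Let $A=(a_{ij})$ be a $d\times m$ matrix of nonnegative integers all of whose column sums are equal. Let $P=(p_1,\dots,p_m)\in\mathbf{R}_{\ge 0}^m$ be a probability distribution, i.e. $p_1+\cdots+p_m=1$. Then $P$ factors according to $A$ or is the limit of probability distributions that factor according to $A$ if and only if $P$ lies in the nonnegative toric variety $X_A$.
   Context: Let $a_j=(a_{1j},\dots,a_{dj})$ denote the $j$-th column of $A$. The convention $t^0=1$ is used for all $t\ge 0$ (in particular $0^0=1$). The monomial map of $A$ is $\phi_A:\mathbf{R}_{\ge 0}^d\to\mathbf{R}_{\ge 0}^m$, $(t_1,\dots,t_d)\mapsto\left(\prod_{i=1}^d t_i^{a_{i1}},\dots,\prod_{i=1}^d t_i^{a_{im}}\right)$. A probability distribution $P$ factors according to $A$ if $P\in\mathrm{image}(\phi_A)$. Limits are taken in the usual topology of $\mathbf{R}^m$. The nonnegative toric variety $X_A$ is the set of all $(x_1,\dots,x_m)\in\mathbf{R}_{\ge 0}^m$ such that $x_1^{u_1}\cdots x_m^{u_m}=x_1^{v_1}\cdots x_m^{v_m}$ whenever $u,v$ are vectors of nonnegative integers satisfying $u_1a_1+\cdots+u_ma_m=v_1a_1+\cdots+v_ma_m$. *)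

(* Defs.v *)
From mathcomp Require Import all_boot all_order all_algebra.
From mathcomp Require Import all_classical all_reals all_analysis.
Set Implicit Arguments.
Unset Strict Implicit.
Unset Printing Implicit Defensive.
Import Order.TTheory GRing.Theory Num.Theory.
Import numFieldNormedType.Exports.
Local Open Scope classical_set_scope.
Local Open Scope ring_scope.

(** Points of R^n are row vectors; [x ^+ 0 = 1] for every [x], including 0. *)

Definition nonneg_orthant (R : realType) (n : nat) : set 'rV[R]_n :=
  [set x | forall i, 0 <= x 0 i].

Definition monomial_map (R : realType) (d m : nat) (A : 'M[nat]_(d, m))
    (t : 'rV[R]_d) : 'rV[R]_m :=
  \row_(j < m) \prod_(i < d) t 0 i ^+ A i j.

Definition prob_dist (R : realType) (m : nat) : set 'rV[R]_m :=
  [set p | nonneg_orthant p /\ \sum_(j < m) p 0 j = 1].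

Definition factors (R : realType) (d m : nat) (A : 'M[nat]_(d, m))
    : set 'rV[R]_m :=
  @monomial_map R d m A @` @nonneg_orthant R d.

Definition limit_of_factoring (R : realType) (d m : nat) (A : 'M[nat]_(d, m))
    (P : 'rV[R]_m) : Prop :=
  exists Q : nat -> 'rV[R]_m,
    (forall n, prob_dist (Q n) /\ factors A (Q n)) /\ Q @ \oo --> P.

(** [col j A *+ u j] is the nonnegative integer multiple [u_j a_j]. *)
Definition toric_variety (R : realType) (d m : nat) (A : 'M[nat]_(d, m))
    : set 'rV[R]_m :=
  [set x | nonneg_orthant x /\
    forall u v : 'I_m -> nat,
      \sum_(j < m) col j A *+ u j = \sum_(j < m) col j A *+ v j ->
      \prod_(j < m) x 0 j ^+ u j = \prod_(j < m) x 0 j ^+ v j].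

Definition equal_column_sums (d m : nat) (A : 'M[nat]_(d, m)) : Prop :=
  forall j k : 'I_m, (\sum_(i < d) A i j = \sum_(i < d) A i k)%N.

(* Main.v *)
Require Import Defs.
From mathcomp Require Import all_boot all_order all_algebra.
From mathcomp Require Import all_classical all_reals all_analysis.
From mathcomp Require Import ring lra.
Set Implicit Arguments.
Unset Strict Implicit.
Unset Printing Implicit Defensive.
Import Order.TTheory GRing.Theory Num.Theory.
Import numFieldNormedType.Exports.
Local Open Scope classical_set_scope.
Local Open Scope ring_scope.

(** Points of the image of the monomial map satisfy the binomial equations,
    which are closed conditions.  Conversely, let P lie in X_A and let F be its
    support.  After clearing denominators, a rational relation between the
    columns of A becomes an equation A u = A v, hence a binomial equation
    P^u = P^v.  Relations supported on F show that (log p_j)_(j in F) is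
    orthogonal to a rational basis of the relations between the a_j with j in
    F, so log p_j = <y, a_j> for some y.  Relations that are nonnegative off F
    must vanish off F, since otherwise exactly one side of P^u = P^v would be
    zero; by Farkas' lemma over the rationals some w satisfies <w, a_j> = 0 on
    F and <w, a_j> > 0 off F.  The points phi_A(exp (y - n w)) then converge to
    P, and equality of the column sums allows them to be normalized by
    rescaling the parameters. *)

(* Bartl's induction on the number of vectors: a point [x] violating the
   implication without the constraint [a i] gives the projection
   [y |-> y + (a i y) x] onto the hyperplane [a i = 0], to which the induction
   hypothesis applies. *)
Lemma farkas (K : realFieldType) (d : nat) (I : eqType) (s : seq I)
    (a : I -> 'rV[K]_d) (b : 'rV[K]_d) : uniq s ->
  (forall x : 'cV[K]_d, (forall i, i \in s -> 0 <= (a i *m x) 0 0) ->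
     0 <= (b *m x) 0 0) ->
  exists2 l : I -> K, (forall i, 0 <= l i) & b = \sum_(i <- s) l i *: a i.
Proof.
elim: s a b => [|k s IH] a b.
  move=> _ nonneg_b; exists (fun=> 0) => //; rewrite big_nil.
  apply/rowP => j; rewrite mxE.
  have dual (x : 'cV[K]_d) : 0 <= (b *m x) 0 0 by exact: nonneg_b.
  have coord : (b *m (delta_mx j 0 : 'cV_d)) 0 0 = b 0 j by rewrite -colE mxE.
  have := dual (delta_mx j 0); have := dual (- delta_mx j 0).
  rewrite mulmxN mxE coord; lra.
move=> /andP[ks us] nonneg_b.
have [nonneg_s|] := pselect (forall x : 'cV[K]_d,
    (forall i, i \in s -> 0 <= (a i *m x) 0 0) -> 0 <= (b *m x) 0 0).
  have [l l_ge0 ->] := IH a b us nonneg_s.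
  exists (fun i => if i == k then 0 else l i) => [i|]; first by case: ifP.
  rewrite big_cons eqxx scale0r add0r; apply: eq_big_seq => i is_.
  by case: eqVneq => // ik; rewrite ik (negPf ks) in is_.
move=> /existsNP[x0 /not_implyP[x0_ge0 /negP]]; rewrite -ltNge => bx0.
have ak0 : (a k *m x0) 0 0 < 0.
  rewrite ltNge; apply/negP => akx0; move: bx0; rewrite ltNge nonneg_b // => i.
  by rewrite inE => /orP[/eqP->|/x0_ge0].
pose x := (- (a k *m x0) 0 0)^-1 *: x0.
have xE e : (e *m x) 0 0 = (- (a k *m x0) 0 0)^-1 * (e *m x0) 0 0.
  by rewrite -scalemxAr mxE.
have c_gt0 : 0 < (- (a k *m x0) 0 0)^-1 by rewrite invr_gt0 oppr_gt0.
have akx : (a k *m x) 0 0 = -1.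
  by rewrite xE invrN mulNr mulVf // lt_eqF.
have x_ge0 i : i \in s -> 0 <= (a i *m x) 0 0.
  by move=> is_; rewrite xE mulr_ge0 ?x0_ge0 // ltW.
have bx : (b *m x) 0 0 < 0 by rewrite xE pmulr_rlt0.
(* Since [a k *m x] is -1, [proj e] is the row [e] composed with the projection along [x] onto the
   hyperplane where [a k] vanishes. *)
pose proj e : 'rV[K]_d := e + (e *m x) 0 0 *: a k.
have linE (e f : 'rV[K]_d) t y :
    ((e + t *: f) *m y) 0 0 = (e *m y) 0 0 + t * (f *m y) 0 0.
  by rewrite mulmxDl -scalemxAl [LHS]mxE [X in _ + X = _]mxE.
have linE' (e : 'rV[K]_d) t y z :
    (e *m (y + t *: z)) 0 0 = (e *m y) 0 0 + t * (e *m z) 0 0.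
  by rewrite mulmxDr -scalemxAr [LHS]mxE [X in _ + X = _]mxE.
have projE e y : (proj e *m y) 0 0 = (e *m (y + (a k *m y) 0 0 *: x)) 0 0.
  by rewrite linE linE' mulrC.
have [//|y y_ge0|l l_ge0 bE] := IH (proj \o a) (proj b).
  rewrite projE; apply: nonneg_b => i; rewrite inE => /orP[/eqP->|is_].
    by rewrite linE' akx mulrN1 subrr.
  by rewrite -projE y_ge0.
(* Expanding [proj] on both sides of [bE] and collecting the multiples of [a k] gives this
   coefficient. It is nonnegative because each [a i] is nonnegative at [x] while [b] is negative
   there. *)
pose lk := \sum_(i <- s) l i * (a i *m x) 0 0 - (b *m x) 0 0.
exists (fun i => if i == k then lk else l i) => [i|].
  case: ifP => // _; rewrite subr_ge0 (le_trans (ltW bx)) //.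
  by rewrite big_seq; apply: sumr_ge0 => j js; rewrite mulr_ge0 ?x_ge0.
rewrite big_cons eqxx (eq_big_seq (fun i => l i *: a i)); last first.
  by move=> i is_; case: eqVneq => // ik; rewrite ik (negPf ks) in is_.
have -> : b = proj b - (b *m x) 0 0 *: a k by rewrite addrK.
rewrite bE scalerBl [RHS]addrAC; congr (_ - _).
rewrite scaler_suml -big_split /=; apply: eq_bigr => i _.
by rewrite scalerDr scalerA addrC.
Qed.

Lemma common_denominator (I : finType) (c : I -> rat) :
  exists2 N : nat, (0 < N)%N &
    exists z : I -> int, forall i, N%:R * c i = (z i)%:~R.
Proof.
exists (\prod_i `|denq (c i)|)%N.
  by rewrite prodn_gt0 // => i; rewrite absz_gt0 denq_neq0.
exists (fun i => (\prod_(k | k != i) `|denq (c k)|)%N%:Z * numq (c i)) => i.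
have den : (`|denq (c i)|%N%:R : rat) = (denq (c i))%:~R.
  by rewrite natr_absz gtr0_norm ?denq_gt0.
by rewrite (bigD1 i) //= natrM intrM numqE den -pmulrn; ring.
Qed.

(** If no such [w] exists, Farkas' lemma puts -a_k in the cone spanned by all columns and the
    negatives of those in [F]. This yields a relation with positive coefficient at [k] and
    nonnegative coefficients off [F]. *)
Lemma cone_facet (d m : nat) (A : 'M[nat]_(d, m)) (F : pred 'I_m) (k : 'I_m) :
  ~~ F k ->
  (forall c : 'I_m -> rat, (forall i, \sum_j c j * (A i j)%:R = 0) ->
     (forall j, ~~ F j -> 0 <= c j) -> c k <= 0) ->
  exists w : 'cV[rat]_d,
    [/\ forall j, F j -> \sum_i w i 0 * (A i j)%:R = 0,
        forall j, 0 <= \sum_i w i 0 * (A i j)%:R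
      & 0 < \sum_i w i 0 * (A i k)%:R].
Proof.
move=> /negPf Fk norel; apply: contrapT => /forallNP no_w.
pose a j : 'rV[rat]_d := \row_i (A i j)%:R.
have aE j w : (a j *m w) 0 0 = \sum_i w i 0 * (A i j)%:R.
  by rewrite mxE; apply: eq_bigr => i _; rewrite mxE mulrC.
(* The flag selects a_j or its negative; off [F] the negative is replaced by the filler 0, so that
   the generators are indexed by a whole finite type. *)
pose g (p : 'I_m * bool) := if p.2 then a p.1 else if F p.1 then - a p.1 else 0.
have [|w w_ge0|l l_ge0 akE] := @farkas _ _ _ (index_enum ('I_m * bool)%type) g (- a k).
- exact: index_enum_uniq.
- rewrite mulNmx mxE oppr_ge0 aE leNgt; apply/negP => w_k; apply: (no_w w).
  have wA j : 0 <= \sum_i w i 0 * (A i j)%:R.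
    by rewrite -aE (w_ge0 (j, true)) ?mem_index_enum.
  split=> // j Fj; apply/eqP; rewrite eq_le wA andbT.
  have := w_ge0 (j, false); rewrite mem_index_enum /g /= Fj mulNmx mxE aE oppr_ge0.
  exact.
pose c j := l (j, true) - (F j)%:R * l (j, false) + (j == k)%:R.
have /norel : forall i, \sum_j c j * (A i j)%:R = 0.
  move=> i; move/rowP: akE => /(_ i); rewrite !mxE summxE.
  rewrite (eq_bigr (fun p => (l (p.1, p.2) *: g (p.1, p.2)) 0 i)) => [|[]//].
  rewrite -(pair_bigA _ (fun j b => (l (j, b) *: g (j, b)) 0 i)) /= => /eqP.
  rewrite eq_sym -subr_eq0 opprK => /eqP rel; rewrite -[RHS]rel {rel}.
  rewrite [X in _ = _ + X](_ : _ = \sum_j (j == k)%:R * (A i j)%:R); last first.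
    rewrite (bigD1 k) //= eqxx mul1r big1 ?addr0 // => j /negPf->.
    by rewrite mul0r.
  rewrite -big_split; apply: eq_bigr => j _ /=; rewrite big_bool /g /= /c !mxE.
  case: (F j); rewrite !mxE ?(mulr1n, mul0r, mul1r, mulrN, mulr0) ?subr0 ?addr0;
    by rewrite -?mulrBl -?mulrDl.
rewrite leNgt => /(_ _)/negP; apply.
  move=> j /negPf Fj; rewrite /c Fj mul0r subr0 addr_ge0 //.
by rewrite /c Fk mul0r subr0 eqxx ltr_wpDl.
Qed.

Lemma cvg_mx (T : topologicalType) (S : Type) (F : set_system S) (FF : Filter F)
    (m n : nat) (f : S -> 'M[T]_(m, n)) (M : 'M[T]_(m, n)) :
  (forall i j, f x i j @[x --> F] --> M i j) -> f @ F --> M.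
Proof.
move=> fM B [P PM PB]; apply: (filterS PB).
by do 2![apply: filter_forall => ?]; exact/fM/PM.
Qed.

Section toric.
Variables (R : realType) (d m : nat) (A : 'M[nat]_(d, m)).
Implicit Types P : 'rV[R]_m.

(** * Binomial equations on the image and its limits *)

Lemma col_sumE (u : 'I_m -> nat) i :
  (\sum_(j < m) col j A *+ u j) i 0 = (\sum_(j < m) A i j * u j)%N.
Proof.
rewrite summxE; apply: eq_bigr => j _.
elim: (u j) => [|k IH]; first by rewrite mulr0n mxE muln0.
by rewrite mulrS mulnS mxE IH mxE.
Qed.

(** The monomial x^u at phi_A(t) equals t^(A u), so it depends on [u] only through A u. *)
Lemma monomial_map_toric (t : 'rV[R]_d) :
  nonneg_orthant t -> toric_variety A (monomial_map A t).
Proof.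
move=> t_ge0; split=> [j|u v uv].
  by rewrite mxE; apply: prodr_ge0 => i _; rewrite exprn_ge0.
have expand (w : 'I_m -> nat) : \prod_j monomial_map A t 0 j ^+ w j =
    \prod_i t 0 i ^+ (\sum_(j < m) A i j * w j)%N.
  under eq_bigr do rewrite mxE -prodrXl; rewrite exchange_big.
  apply: eq_bigr => i _; rewrite -prodrXr.
  by apply: eq_bigr => j _; rewrite exprM.
rewrite !expand; apply: eq_bigr => i _.
by move/colP: uv => /(_ i); rewrite !col_sumE => ->.
Qed.

Lemma cvg_coord (Q : nat -> 'rV[R]_m) P j :
  Q @ \oo --> P -> Q n 0 j @[n --> \oo] --> P 0 j.
Proof.
by move=> QP; apply: (continuous_cvg _ (@coord_continuous _ _ _ 0 j P) QP).
Qed.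

Lemma cvg_monomial (Q : nat -> 'rV[R]_m) P (u : 'I_m -> nat) :
  Q @ \oo --> P -> \prod_j Q n 0 j ^+ u j @[n --> \oo] --> \prod_j P 0 j ^+ u j.
Proof.
move=> QP; apply: (cvg_big (@mul_continuous R)) => j _.
apply: (@continuous_cvg _ _ _ _ _ _ (fun x : R => x ^+ u j)).
  exact: exprn_continuous.
exact: cvg_coord.
Qed.

Lemma toric_variety_closed (Q : nat -> 'rV[R]_m) P :
  (forall n, toric_variety A (Q n)) -> Q @ \oo --> P -> toric_variety A P.
Proof.
move=> Qtoric QP; split=> [j|u v uv].
  apply: (cvgr_to_ge (cvg_coord (j := j) QP)).
  by apply: nearW => n; have [] := Qtoric n.
have := @cvg_monomial Q P u QP.
rewrite (_ : (fun n => _) = fun n => \prod_j Q n 0 j ^+ v j).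
  by move=> QPu; exact: (cvg_unique _ QPu (cvg_monomial QP)).
by apply/funext => n; have [_] := Qtoric n; exact.
Qed.

(** * Supports and logarithms of points of the toric variety *)

(** [u] and [v] are the positive and negative parts of an integral multiple of [c], so the signs of
    [c] tell which coordinates occur on each side of the binomial equation. *)
Lemma toric_rational_relation P (c : 'I_m -> rat) : toric_variety A P ->
  (forall i, \sum_j c j * (A i j)%:R = 0) ->
  exists2 N : nat, (0 < N)%N & exists u v : 'I_m -> nat,
    [/\ forall j, N%:R * c j = (u j)%:R - (v j)%:R,
        forall j, (0 < u j)%N = (0 < c j), forall j, (0 < v j)%N = (c j < 0)
      & \prod_j P 0 j ^+ u j = \prod_j P 0 j ^+ v j].
Proof.
move=> [_ toricP] rel; have [N N_gt0 [z zE]] := common_denominator c.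
exists N => //.
pose u j := if 0 <= z j then `|z j|%N else 0%N.
pose v j := if 0 <= z j then 0%N else `|z j|%N.
have uvE j : N%:R * c j = (u j)%:R - (v j)%:R.
  rewrite zE /u /v; case: (z j) => k /=; first by rewrite subr0 -pmulrn.
  by rewrite NegzE mulrNz sub0r -pmulrn.
have sgc j : (0 < c j) = (0 < z j) /\ (c j < 0) = (z j < 0).
  have := zE j; have Np : 0 < N%:R :> rat by rewrite ltr0n.
  by rewrite -(pmulr_rgt0 _ Np) -(pmulr_rlt0 _ Np) => ->; rewrite ltr0z ltrz0.
exists u, v; split=> // [j|j|].
- by rewrite (sgc j).1 /u; case: (z j) => [[]|].
- by rewrite (sgc j).2 /v; case: (z j) => [[]|].
apply: toricP; apply/colP => i; rewrite !col_sumE.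
apply/eqP; rewrite -(eqr_nat rat) -subr_eq0 !natr_sum -sumrB; apply/eqP.
transitivity (N%:R * \sum_j c j * (A i j)%:R); last by rewrite rel mulr0.
rewrite mulr_sumr; apply: eq_bigr => j _.
by rewrite !natrM mulrA uvE; ring.
Qed.

(** One weight from [cone_facet] is taken for each zero coordinate of [P], and these are added up.
    Each is nonnegative on all columns, so its strict positivity at its own column survives in the
    sum. *)
Lemma facial_weight P : toric_variety A P ->
  exists2 w : 'I_d -> R,
    (forall j, P 0 j != 0 -> \sum_i w i * (A i j)%:R = 0) &
    forall j, P 0 j = 0 -> 0 < \sum_i w i * (A i j)%:R.
Proof.
move=> toricP.
have facet k : exists w : 'cV[rat]_d, P 0 k = 0 ->
    [/\ forall j, P 0 j != 0 -> \sum_i w i 0 * (A i j)%:R = 0,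
        forall j, 0 <= \sum_i w i 0 * (A i j)%:R
      & 0 < \sum_i w i 0 * (A i k)%:R].
  have [Pk|Pk] := eqVneq (P 0 k) 0; last first.
    by exists 0 => Pk0; rewrite Pk0 eqxx in Pk.
  have [||w wP] := @cone_facet d m A (fun j => P 0 j != 0) k; last by exists w.
    by rewrite Pk eqxx.
  move=> c rel c_ge0; rewrite leNgt; apply/negP => ck.
  have [N _ [u [v [_ uc vc]]]] := toric_rational_relation toricP rel.
  (* The left side vanishes because [P 0 k = 0] and [u k > 0]. Hence some factor on the right
     vanishes, and there [c j < 0] and [P 0 j = 0]. *)
  rewrite (bigD1 k) //= Pk expr0n gtn_eqF ?uc // mul0r => /esym/eqP/prodf_eq0[j _].
  rewrite expf_eq0 vc => /andP[cj /eqP Pj]; move: cj.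
  by rewrite ltNge c_ge0 // Pj eqxx.
have [w wP] := choice facet.
pose W i := \sum_(k | P 0 k == 0) w k i 0.
have WE j : \sum_i W i * (A i j)%:R =
    \sum_(k | P 0 k == 0) \sum_i w k i 0 * (A i j)%:R.
  by under eq_bigr do rewrite mulr_suml; rewrite exchange_big.
have ratrE j : \sum_i ratr (W i) * (A i j)%:R =
    ratr (\sum_i W i * (A i j)%:R) :> R.
  by rewrite rmorph_sum; apply: eq_bigr => i _; rewrite rmorphM /= ratr_nat.
exists (fun i => ratr (W i)) => j Pj; rewrite ratrE.
  by rewrite WE big1 ?rmorph0 // => k /eqP/wP[w0 _ _]; exact: w0.
rewrite ltr0q WE (bigD1 j) ?Pj //= ltr_pwDl //; first by have [] := wP j Pj.
by apply: sumr_ge0 => k /andP[/eqP/wP[_ + _] _]; apply.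
Qed.

Lemma log_linear P : toric_variety A P ->
  exists y : 'I_d -> R,
    forall j, P 0 j != 0 -> expR (\sum_i y i * (A i j)%:R) = P 0 j.
Proof.
move=> toricP; have P_ge0 := toricP.1.
(* Columns off the support are set to zero, which matches the default value [ln 0 = 0] in [L]. *)
pose B : 'M[rat]_(d, m) := \matrix_(i, j) if P 0 j != 0 then (A i j)%:R else 0.
pose L : 'rV[R]_m := \row_j ln (P 0 j).
have /submxP[y Ly] : (L <= map_mx ratr B)%MS.
  (* Row space membership is tested on the cokernel, which is rational because [B] is. Each of its
     columns, cut down to the support of [P], is a relation between the columns of [A]. *)
  rewrite submxE -map_cokermx; apply/eqP.
  move: (cokermx B) (mulmx_coker B) => C BC; apply/rowP => k; rewrite !mxE.
  pose c j := if P 0 j != 0 then C j k else 0.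
  have rel i : \sum_j c j * (A i j)%:R = 0.
    move/matrixP: BC => /(_ i k); rewrite !mxE => coker0.
    rewrite -[RHS]coker0; apply: eq_bigr => j _; rewrite !mxE /c; case: ifP => _.
      by rewrite mulrC.
    by rewrite !mul0r.
  have [N N_gt0 [u [v [uvE uc vc]]]] := toric_rational_relation toricP rel.
  have prodE (e : 'I_m -> nat) : (forall j, (0 < e j)%N -> P 0 j != 0) ->
      \prod_j P 0 j ^+ e j = expR (\sum_j (e j)%:R * ln (P 0 j)).
    move=> eP; rewrite expR_sum; apply: eq_bigr => j _; rewrite expRM_natl.
    have [->|] := posnP (e j); first by rewrite !expr0.
    by move=> /eP Pj; rewrite lnK // posrE lt_neqAle eq_sym Pj P_ge0.
  rewrite !prodE; last 2 first.
  - by move=> j; rewrite vc /c; case: ifP.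
  - by move=> j; rewrite uc /c; case: ifP.
  move=> /expR_inj /eqP; rewrite -subr_eq0 -sumrB => /eqP sum0.
  have : N%:R != 0 :> R by rewrite pnatr_eq0 -lt0n.
  move=> /mulfI; apply; rewrite mulr0 mulr_sumr -[RHS]sum0.
  apply: eq_bigr => j _; rewrite !mxE.
  have : N%:R * ratr (c j) = (u j)%:R - (v j)%:R :> R.
    by rewrite -!(ratr_nat R) -rmorphM uvE rmorphB.
  rewrite -mulrBl => <-; rewrite /c; case: ifP => [_|/negbFE/eqP ->].
    by rewrite mulrCA mulrC.
  by rewrite ln0 // mul0r !mulr0.
exists (y 0) => j Pj; rewrite -[RHS](@lnK R); last first.
  by rewrite posrE lt_neqAle eq_sym Pj P_ge0.
move/rowP: Ly => /(_ j); rewrite !mxE => ->; congr expR.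
by apply: eq_bigr => i _; rewrite !mxE Pj ratr_nat.
Qed.

(** * Approximation by normalized points of the image *)

Lemma monomial_map_expR (z : 'I_d -> R) j :
  monomial_map A (\row_i expR (z i)) 0 j = expR (\sum_i z i * (A i j)%:R).
Proof.
by rewrite mxE expR_sum; apply: eq_bigr => i _; rewrite mxE expRM_natr.
Qed.

Lemma factors_monomial_map_expR (z : 'I_d -> R) :
  factors A (monomial_map A (\row_i expR (z i))).
Proof.
by exists (\row_i expR (z i)) => // i; rewrite mxE expR_ge0.
Qed.

Lemma toric_limit_of_factoring P : equal_column_sums A -> prob_dist P ->
  toric_variety A P -> ~ factors A P -> limit_of_factoring A P.
Proof.
move=> hA [_ P1] toricP nfP.
have [w w0 w_gt0] := facial_weight toricP.
have [y yP] := log_linear toricP.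
(* Without a zero coordinate, [P] would be phi_A(exp y) and would factor. *)
have [j0 Pj0] : exists j, P 0 j = 0.
  apply: contrapT => /forallNP Pn0; apply: nfP.
  suff -> : P = monomial_map A (\row_i expR (y i)).
    exact: factors_monomial_map_expR.
  by apply/rowP => j; rewrite monomial_map_expR yP //; exact/eqP/Pn0.
pose s : R := (\sum_i A i j0)%N%:R.
(* The weight [w] is positive on column [j0], so that column is not zero. *)
have s_neq0 : s != 0.
  rewrite pnatr_eq0; apply: contraTneq (w_gt0 j0 Pj0) => /eqP.
  rewrite sum_nat_eq0 => /forallP Aj0; rewrite big1 ?ltxx // => i _.
  by rewrite (eqP (Aj0 i)) mulr0.
pose q n j : R := expR (\sum_i (y i - n%:R * w i) * (A i j)%:R).
pose S n := \sum_j q n j.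
have S_gt0 n : 0 < S n.
  rewrite /S (bigD1 j0) //= ltr_pwDl ?expR_gt0 // sumr_ge0 // => j _.
  exact: expR_ge0.
(* Every column sums to [s], so multiplying all parameters by (S n)^(-1/s) divides each coordinate
   by [S n]. *)
pose Q n := monomial_map A (\row_i expR (y i - n%:R * w i - ln (S n) / s)).
have QE n j : Q n 0 j = q n j / S n.
  rewrite /Q monomial_map_expR /q -[S n in RHS]lnK ?posrE // -expRB.
  congr expR; under eq_bigr do rewrite mulrBl; rewrite sumrB; congr (_ - _).
  by rewrite -mulr_sumr -natr_sum (hA j j0) divfK.
(* In [n] this is a geometric sequence of ratio exp(-<w, a_j>), which is 1 on the support of [P] and
   below 1 off it. *)
have qE n j : q n j = expR (\sum_i y i * (A i j)%:R) *
    expR (- \sum_i w i * (A i j)%:R) ^+ n.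
  rewrite -expRM_natl -expRD; congr expR; rewrite mulrN mulr_sumr -sumrB.
  by apply: eq_bigr => i _; ring.
have qP j : q n j @[n --> \oo] --> P 0 j.
  rewrite (_ : (fun n => _) = fun n => expR (\sum_i y i * (A i j)%:R) *
    expR (- \sum_i w i * (A i j)%:R) ^+ n); last by apply/funext => n; exact: qE.
  have [Pj|Pj] := eqVneq (P 0 j) 0.
    rewrite Pj -[X in _ --> X](mulr0 (expR (\sum_i y i * (A i j)%:R))).
    apply: cvgM; first exact: cvg_cst.
    by apply: cvg_expr; rewrite ger0_norm ?expR_ge0 // expR_lt1 oppr_lt0 w_gt0.
  rewrite w0 // oppr0 expR0 yP //.
  by under eq_fun do rewrite expr1n mulr1; exact: cvg_cst.
have SP : S n @[n --> \oo] --> (1 : R).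
  rewrite -P1; apply: (cvg_big (@add_continuous R)) => j _.
  exact: qP.
exists Q; split=> [n|].
  split; last exact: factors_monomial_map_expR.
  split=> [j|]; first by rewrite QE divr_ge0 ?expR_ge0 // ltW.
  by under eq_bigr do rewrite QE; rewrite -mulr_suml -/(S n) divff // gt_eqF.
apply: cvg_mx => i j; rewrite ord1.
rewrite (_ : (fun n => _) = fun n => q n j * (S n)^-1); last first.
  by apply/funext => n; rewrite QE.
rewrite -[P 0 j]mulr1 -[X in _ * X]invr1; apply: cvgM; first exact: qP.
by apply: cvgV => //; exact: oner_neq0.
Qed.

End toric.

Theorem theorem3p2 (R : realType) (d m : nat) (A : 'M[nat]_(d, m))
    (hA : equal_column_sums A) (P : 'rV[R]_m) (hP : prob_dist P) :
  factors A P \/ limit_of_factoring A P <-> toric_variety A P.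
Proof.
have factors_toric Q : factors A Q -> toric_variety A Q.
  by move=> [t t_ge0 <-]; exact: monomial_map_toric.
split=> [[/factors_toric //|[Q [QF QP]]]|toricP].
  by apply: toric_variety_closed QP => n; apply: factors_toric; have [] := QF n.
have [fP|nfP] := pselect (factors A P); [by left|right].
exact: toric_limit_of_factoring.
Qed.
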